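(* Let $k$ be a positive integer and let $G$ be an oriented graph with vertex set $V(G)$ and with more than $(5k+4)|V(G)|/4$ edges. Then $G$ contains an alternating path with $k$ vertices.
   Context: An oriented graph is a pair $G=(V,\vec{D})$, where $V=V(G)$ is a finite set of vertices and $\vec{D}$ is a set of (directed) edges; each edge is an ordered pair of distinct vertices, and for all $u,v$ at most one of $(u,v)$ and $(v,u)$ is an edge. A path in $G$ is a (not necessarily induced) subgraph of $G$ whose underlying undirected graph is a path, so the vertices of a path are distinct. A path is alternating if every vertex of the path is incident, within the path, either only with incoming edges or only with outgoing edges. *)

(* Defs.v *)
From mathcomp Require Import all_boot all_order all_algebra.
Set Implicit Arguments.
Unset Strict Implicit.
Unset Printing Implicit Defensive.

Record oriented_graph := OrientedGraph {
  vertex :> finType;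
  edges : {set vertex * vertex};
  edges_loopless : forall u : vertex, (u, u) \notin edges;
  edges_oriented : forall u v : vertex, (u, v) \in edges -> (v, u) \notin edges
}.

Section Paths.
Variable G : oriented_graph.
Implicit Types (p : seq G) (u v : G).

Definition adjacent u v : bool := ((u, v) \in edges G) || ((v, u) \in edges G).

(* A path is given by listing its vertices from one end to the other; its edges
   need not be consistently directed. *)
Definition is_path p : bool := uniq p && sorted adjacent p.

Definition consecutive p u v : bool := infix [:: u; v] p || infix [:: v; u] p.

(* Only edges of G between consecutive vertices of p belong to the path (a path
   need not be induced).  Since G is oriented, the vertex list p determines
   these edges and their directions. *)
Definition path_edges p : {set G * G} :=
  [set e in edges G | consecutive p e.1 e.2].

Definition is_alternating p : Prop :=
  forall v, v \in p ->
    (forall u, (v, u) \notin path_edges p) \/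
    (forall u, (u, v) \notin path_edges p).

End Paths.

(* Main.v *)
Require Import Defs.
From mathcomp Require Import all_boot all_order all_algebra.
From mathcomp Require Import zify.
Set Implicit Arguments.
Unset Strict Implicit.
Unset Printing Implicit Defensive.
Import Order.TTheory GRing.Theory Num.Theory.

(** Split every vertex v into an out-copy (v, true) and an in-copy (v, false),
    and let an edge (u, v) of G join (u, true) to (v, false).  In this bipartite
    double cover the sides alternate along a path, so a path that uses at most
    one copy of each vertex is the same thing as an alternating path of G; call
    it lifted.  The number of edges exceeds (5k+4)/8 times the number of
    vertices of the cover, and a minimal vertex set X with this property
    ([minimal_dense]) has the stronger property that every nonempty S inside X
    touches more than (5k+4)|S|/8 of its edges.  For singletons this gives a
    minimum degree delta > 5k/8.

    Suppose that a longest lifted path p has m < k vertices.  An end of a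
    lifted path on m vertices has all its neighbours over the vertices of that
    path ([nbrs_head]); otherwise the path could be extended.  Three arguments
    exploit this.

    Rotations ([long_end]).  Fix the last vertex and let x be the head with most
    neighbours on the path, among the lifted paths on the elements of p; let d be
    this number.  The rotations at x produce d heads, all on one side.  Because
    G is oriented, the bonds from the set S of heads to the opposite copies of
    the members of S number at most |S|^2/2, and the degree sum over S yields
    2 delta <= d + 2 ceil(m/2) ([max_degree_end]).  Done from both ends, this
    produces a path from x to z whose ends both have many neighbours on it.

    m even.  The two degrees are so large that their neighbourhoods cross and
    close the path into a cycle ([even_crossing]).  Every vertex of the cycle is
    the end of a path, so all edges touching it lie over its m vertices; these
    are at most m^2/2 edges, contradicting the density of X
    ([spanning_cycle_touching]).

    m odd.  The neighbourhoods cross around one vertex w, and closing up gives a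
    cycle c on the other m - 1 vertices ([odd_crossing]).  As w has more than
    (m - 1)/2 neighbours, all over c, some a on c has both its opposite copy and
    its successor on c adjacent to w.  Going from w around the cycle up to a, and
    going from the opposite copy of a through w around the cycle, shows that both
    copies of a are ends of paths on m vertices.  Since G is oriented, the degrees
    of the two copies of a add up to at most m, whereas 2 delta > m
    ([near_spanning_cycle]). *)

(** * Sequences, cycles and counting *)

Section Sequences.
Variables (T : eqType) (e : rel T).

Lemma count_sum_nth (x0 : T) (a : pred T) (s : seq T) :
  count a s = \sum_(i < size s) a (nth x0 s i).
Proof. by rewrite -sum1_count big_mkcond (big_nth x0) big_mkord; apply: eq_bigr. Qed.

(** Pigeonhole for two sets of indices inside a third one, stated with sums of
    booleans so that it applies to counts along a sequence. *)
Lemma crossing_index n (f g h : nat -> bool) :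
    (forall i, i < n -> f i -> h i) -> (forall i, i < n -> g i -> h i) ->
    \sum_(i < n) h i < \sum_(i < n) f i + \sum_(i < n) g i ->
  exists i, [/\ i < n, f i & g i].
Proof.
move=> fh gh; rewrite -big_split /= ltnNge => /negP h_lt.
have [/existsP[i /andP[fi gi]]|/existsPn no_i] :=
  boolP [exists i : 'I_n, f i && g i]; first by exists i.
case: h_lt; apply: leq_sum => i _.
have := no_i i; have := fh i (ltn_ord i); have := gh i (ltn_ord i).
by case: (f i); case: (g i) => //=; case: (h i) => // gi fi;
  rewrite ?(gi isT) ?(fi isT).
Qed.

(** Two paths whose heads are joined and whose ends are joined form a cycle, the
    second path being traversed backwards.  Both crossing arguments close up
    the two pieces of a cut path in this way. *)
Lemma splice_cycle x s y t : symmetric e ->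
    path e x s -> path e y t -> e x y -> e (last x s) (last y t) ->
  cycle e ((x :: s) ++ rev (y :: t)).
Proof.
move=> e_sym xs yt xy last_st; rewrite /= rcons_path cat_path xs /=.
rewrite last_cat {2}rev_cons last_rcons e_sym xy andbT.
rewrite lastI rev_rcons /= last_st /= rev_path.
by rewrite (eq_path (e' := e)) // => u v; rewrite e_sym.
Qed.

Lemma cycle_start c x : cycle e c -> x \in c ->
  exists2 q, perm_eq (x :: q) c & path e x q.
Proof.
move=> c_cyc /rot_to[i q def_q]; exists q; first by rewrite -def_q perm_rot.
have: cycle e (x :: q) by rewrite -def_q rot_cycle.
by rewrite /= rcons_path => /andP[].
Qed.

End Sequences.

(** Predecessors are computed through [prev] because it is injective on the whole
    type: this counts the heads produced by rotations. *)
Lemma prev_splitr (T : eqType) (x : T) q1 y q2 : uniq (x :: q1 ++ y :: q2) ->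
  prev (x :: q1 ++ y :: q2) y = last x q1.
Proof.
move=> p_uniq; have := prev_next p_uniq (last x q1).
suff -> : next (x :: q1 ++ y :: q2) (last x q1) = y by [].
rewrite next_nth -cat_cons mem_cat mem_last orTb index_cat mem_last index_last; last first.
  by move: p_uniq; rewrite -cat_cons cat_uniq => /and3P[].
by rewrite nth_cat ltnn subnn.
Qed.

Lemma take_last (T : Type) (x : T) (q : seq T) i : i <= size q ->
  last x (take i q) = nth x (x :: q) i.
Proof.
by move=> le_i; rewrite (last_nth x) size_takel //; case: i le_i => //= i lt_i; rewrite nth_take.
Qed.

Lemma uniq_map_inj_in (T U : eqType) (f : T -> U) (s : seq T) :
  uniq [seq f x | x <- s] -> {in s &, injective f}.
Proof.
elim: s => // v s IHs /= /andP[v_new s_uniq] x y; rewrite !inE.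
case/orP=> [/eqP->|xs] /orP[/eqP->|ys] // xy; last exact: IHs.
  by rewrite xy map_f in v_new.
by rewrite -xy map_f in v_new.
Qed.

Lemma count_card (T : finType) (a : pred T) (p : seq T) : uniq p ->
  count a p = #|[set y in p | a y]|.
Proof.
move=> p_uniq; rewrite -size_filter -(card_uniqP (filter_uniq a p_uniq)).
by apply: eq_card => y; rewrite !inE mem_filter andbC.
Qed.

(** * Numerical bounds *)

(** In this bound and the next, the path has n + 1, respectively n + 2, vertices,
    and dx and dz are the numbers of neighbours that its two ends have on it; the
    two inequalities on delta are the outcome of the rotation argument. *)
Lemma even_crossing_bound n k delta dx dz : odd n -> n.+1 < k -> 5 * k + 5 <= 8 * delta ->
    2 * delta <= dx + 2 * uphalf n.+1 -> 2 * delta <= dz + 2 * uphalf n.+1 ->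
  uphalf n < dx + dz.
Proof.
move=> odd_n; have [r ->] : exists r, n = r.*2.+1.
  by exists n./2; rewrite -{1}(odd_double_half n) odd_n.
have -> : uphalf r.*2.+1 = r.+1 by rewrite /= half_double.
have -> : uphalf r.*2.+2 = r.+1 by rewrite /= uphalf_double.
by rewrite -mul2n; lia.
Qed.

(** The loss of 3 is what [odd_crossing] asks for; the additive constant 4 in the
    edge bound is what pays for it. *)
Lemma odd_crossing_bound n k delta dx dz : odd n -> n.+2 < k -> 5 * k + 5 <= 8 * delta ->
    2 * delta <= dx + 2 * uphalf n.+2 -> 2 * delta <= dz + 2 * uphalf n.+2 ->
  uphalf n + 3 < dx + dz.
Proof.
move=> odd_n; have [r ->] : exists r, n = r.*2.+1.
  by exists n./2; rewrite -{1}(odd_double_half n) odd_n.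
have -> : uphalf r.*2.+1 = r.+1 by rewrite /= half_double.
have -> : uphalf r.*2.+3 = r.+2 by rewrite /= half_double.
by rewrite -mul2n; lia.
Qed.

(** With t the number of edges touching a spanning cycle, the conclusion
    contradicts the density (5k+4)/8. *)
Lemma spanning_cycle_bound m k t : m < k -> 2 * t <= m * m -> 8 * t <= (5 * k + 4) * m.
Proof.
move=> lt_m le_t; apply: (@leq_trans (4 * m * m)).
  by rewrite -mulnA -(mulnA 4 2 t) leq_mul2l.
by rewrite leq_mul2r; apply/orP; right; lia.
Qed.

(** * The bipartite double cover *)

Section DoubleCover.
Variable G : oriented_graph.
Local Notation cover := (G * bool)%type.
Implicit Types (x y z : cover) (p q c : seq cover) (X S : {set cover}).

Definition flip x : cover := (x.1, ~~ x.2).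

Definition bond : rel cover := fun x y =>
  (x.2 != y.2) && (if x.2 then (x.1, y.1) \in edges G else (y.1, x.1) \in edges G).

Lemma bond_sym : symmetric bond.
Proof. by move=> [u []] [v []]. Qed.

Lemma bond_side x y : bond x y -> y.2 = ~~ x.2.
Proof. by case: x y => u [] [v []]. Qed.

Lemma bond_base x y : bond x y -> x.1 != y.1.
Proof.
by case: x y => u [] [v []] //=; rewrite /bond /= => uv; apply: contraTneq uv => ->;
  exact: edges_loopless.
Qed.

Lemma bond_irr x : bond x x = false.
Proof. by rewrite /bond eqxx. Qed.

(** Orientedness of G, seen in the cover: of the two crosswise pairs of copies of two
    vertices, at most one is joined. *)
Lemma bond_flip x y : bond x y -> ~~ bond (flip x) (flip y).
Proof. by case: x y => u [] [v []] //=; exact: edges_oriented. Qed.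

Lemma flipK : involutive flip.
Proof. by case=> u b; rewrite /flip /= negbK. Qed.

Lemma path_side x p : path bond x p -> (last x p).2 = x.2 (+) odd (size p).
Proof.
elim: p x => [|y p IHp] x /=; first by rewrite addbF.
by case/andP=> /bond_side xy /IHp ->; rewrite xy; case: x.2 (odd _) => [] [].
Qed.

(** The sides alternate along a path, so the side of the head occurs half of the
    time, rounded up. *)
Lemma count_side x p b : path bond x p ->
  count (fun y => y.2 == b) (x :: p) =
  if x.2 == b then uphalf (size p).+1 else (size p).+1./2.
Proof.
elim: p x => [|y p IHp] x; first by rewrite /=; case: eqVneq.
case/andP=> /bond_side xy /IHp yp; rewrite -cat1s count_cat yp xy /= addn0.
by case: x.2 {IHp yp} b => [] [] /=; lia.
Qed.

(** The edges of the subgraph of the cover induced by X; each is represented by the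
    edge of G that it comes from. *)
Definition inner X := [set e in edges G | ((e.1, true) \in X) && ((e.2, false) \in X)].

(** Edges inside X with at least one end in S, written as those destroyed when S is
    removed: in this form the minimality of X bounds their number at once. *)
Definition touching X S := inner X :\: inner (X :\: S).

Definition nbrs X x := [set y in X | bond x y].

Lemma mem_touching X S (e : G * G) : e \in touching X S -> e \in edges G /\
  [/\ (e.1, true) \in X, (e.2, false) \in X
    & ((e.1, true) \in S) || ((e.2, false) \in S)].
Proof.
rewrite !inE /=; case: (_ \in edges _) => //=.
by case: (_ \in S); case: (_ \in S); case: (_ \in X); case: (_ \in X).
Qed.

(** Take X minimal with density above a/d.  Removing S leaves a set of density at
    most a/d, so the edges lost have density above a/d relative to S. *)
Lemma minimal_dense (a d : nat) : a * (#|G| * 2) < d * #|edges G| ->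
  exists X, X != set0 /\
    forall S, S \subset X -> S != set0 -> a * #|S| < d * #|touching X S|.
Proof.
move=> dense_G; pose P X := a * #|X| < d * #|inner X|.
have [|X /minsetP[PX X_min]] := @ex_minset _ P.
  exists setT; rewrite /P cardsT card_prod card_bool.
  by rewrite (_ : inner _ = edges G) //; apply/setP=> e; rewrite !inE /= andbT.
exists X; split.
  apply: contraTneq PX => ->; rewrite /P cards0 muln0 -leqNgt leqn0 muln_eq0 cards_eq0.
  by apply/orP; right; apply/eqP/setP=> e; rewrite !inE /= andbF.
move=> S SX /set0Pn[s Ss]; have: ~~ P (X :\: S).
  apply: contraL (subsetP SX s Ss) => PS.
  by rewrite -(X_min _ PS (subsetDl _ _)) inE Ss.
rewrite /P -leqNgt cardsD (setIidPr SX) cardsD.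
rewrite (setIidPr (_ : inner (X :\: S) \subset inner X)); last first.
  by apply/subsetP=> e; rewrite !inE => /and3P[-> /andP[_ ->] /andP[_ ->]].
move: PX (subset_leq_card SX); rewrite /P !mulnBr => PX lSX.
have := leq_mul (leqnn a) lSX; lia.
Qed.

(** Through this bound, density applied to a single vertex yields a minimum
    degree. *)
Lemma card_touching1 X x : #|touching X [set x]| <= #|nbrs X x|.
Proof.
pose g (y : cover) := if x.2 then (x.1, y.1) else (y.1, x.1).
apply: leq_trans (leq_imset_card g _); apply: subset_leq_card.
apply/subsetP=> -[u v] /mem_touching[/= uv [uX vX]].
rewrite !inE => /orP[] /eqP def_x; apply/imsetP; rewrite /g -def_x /=.
  by exists (v, false); rewrite // inE vX /bond.
by exists (u, true); rewrite // inE uX /bond.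
Qed.

(** Adding the reversed pairs doubles an oriented set of edges inside V x V. *)
Lemma card_oriented (E : {set G * G}) (V : {set G}) :
  E \subset edges G -> E \subset setX V V -> 2 * #|E| <= #|V| * #|V|.
Proof.
move=> /subsetP EG /subsetP EV; pose sw (e : G * G) := (e.2, e.1).
have sw_inj : injective sw by case=> a b [a' b'] [-> ->].
have: #|E :|: sw @: E| <= #|setX V V|.
  apply/subset_leq_card/subsetP=> e /setUP[/EV//|/imsetP[f /EV]].
  by rewrite !inE => /andP[f1 f2] ->; apply/andP.
rewrite cardsX cardsU (card_imset _ sw_inj) (_ : _ :&: _ = set0) ?cards0 ?subn0 ?addnn ?mul2n //.
apply/setP=> -[u v]; rewrite !inE; apply/negP=> /andP[/EG /= uv /imsetP[[a b] /EG /= ab] [ua vb]].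
by move: (edges_oriented uv); rewrite ua vb ab.
Qed.

(** * Lifted paths and rotations *)

(** Injectivity is required after projection to G: the two copies of a vertex may
    not both occur. *)
Definition lifted_path X p := [&& all (mem X) p, uniq [seq x.1 | x <- p] & sorted bond p].

Lemma lifted_path_uniq X p : lifted_path X p -> uniq p.
Proof. by case/and3P=> _ /map_uniq. Qed.

Lemma lifted_path_rev X p : lifted_path X p -> lifted_path X (rev p).
Proof.
case/and3P=> pX p_uniq p_path; rewrite /lifted_path all_rev pX map_rev rev_uniq p_uniq.
rewrite rev_sorted; case: p p_path {pX p_uniq} => //= x p.
by rewrite (eq_path (e' := bond)) // => u v; rewrite bond_sym.
Qed.

Lemma lifted_path_perm X x p q : lifted_path X p -> perm_eq (x :: q) p -> path bond x q ->
  lifted_path X (x :: q).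
Proof.
case/and3P=> pX p_uniq _ pq xq; rewrite /lifted_path /= xq andbT.
by rewrite -[_ && all _ _]/(all (mem X) (x :: q)) (perm_all _ pq) pX
   -[_ && uniq _]/(uniq [seq z.1 | z <- x :: q]) (perm_uniq (perm_map _ pq)).
Qed.

(** The rotation of Posa: a neighbour y of the head x lets the segment before y be
    reversed, and the predecessor of y becomes the new head. *)
Lemma rotation X x q1 y q2 : lifted_path X (x :: q1 ++ y :: q2) -> bond x y ->
  lifted_path X (rev (x :: q1) ++ y :: q2).
Proof.
move=> good_p xy; have := good_p; rewrite /lifted_path => /and3P[_ _].
rewrite /= cat_path /= => /and3P[xq1 _ yq2].
rewrite lastI rev_rcons /=; apply: lifted_path_perm good_p _ _.
  by rewrite -!cat_cons -rev_rcons -lastI perm_cat2r perm_rev.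
rewrite cat_path /= yq2 andbT rev_path (eq_path (e' := bond)) ?xq1; last first.
  by move=> u v; rewrite bond_sym.
rewrite (_ : last _ _ = x) //; have := rev_cons x q1.
by rewrite lastI rev_rcons => /(congr1 (last x)); rewrite last_rcons.
Qed.

(** Orientedness allows at most one of the bonds from s to the opposite copy of a
    and from a to the opposite copy of s, so at most half of the ordered pairs
    contribute. *)
Lemma flip_bonds_le (S : {set cover}) :
  2 * (\sum_(s in S) #|[set a in S | bond s (flip a)]|) <= #|S| * #|S|.
Proof.
have cardE s : #|[set a in S | bond s (flip a)]| = \sum_(a in S) (bond s (flip a) : nat).
  by rewrite -sum1_card big_mkcond [RHS]big_mkcond; apply: eq_bigr => a _;
    rewrite !inE; case: (a \in S) (bond _ _) => [] [].
under eq_bigr do rewrite cardE.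
rewrite mul2n -addnn {2}exchange_big -big_split /=.
rewrite -sum_nat_const; apply: leq_sum => s _; rewrite -big_split /= -sum1_card.
apply: leq_sum => a _; have := @bond_flip s (flip a); rewrite flipK [bond (flip s) a]bond_sym.
by case: (bond s _) => [/(_ isT)|_]; case: (bond a _).
Qed.

Section LongestPath.
Variables (X : {set cover}) (m delta : nat).
Hypothesis longest : forall p, lifted_path X p -> size p <= m.
Hypothesis min_degree : forall x, x \in X -> delta <= #|nbrs X x|.

(** A neighbour over a new vertex could be put in front of the path. *)
Lemma nbrs_head x q y : lifted_path X (x :: q) -> (size q).+1 = m -> y \in nbrs X x ->
  y.1 \in [seq z.1 | z <- x :: q].
Proof.
move=> good_q size_q; rewrite inE => /andP[yX xy]; apply/negPn/negP=> y_new.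
suff /longest: lifted_path X (y :: x :: q) by rewrite /= size_q ltnn.
case/and3P: good_q => qX q_uniq q_path.
by rewrite /lifted_path /= yX y_new bond_sym xy /= -[path _ _ _]/(sorted bond (x :: q)) q_path
  andbT; apply/andP.
Qed.

(** The set S will consist of possible heads.  A head s has at most M neighbours
    among the elements of p.  Its other neighbours are opposite copies of elements
    of p on the side b of s: those over S are counted by [flip_bonds_le] with the
    factor 1/2, and each of the remaining elements of that side is counted at most
    once for each s.  Summing over S and dividing by |S| gives the bound. *)
Lemma max_degree_end (S : {set cover}) p b M : lifted_path X p -> S != set0 -> {subset S <= p} ->
    (forall s, s \in S -> s.2 = b) ->
    (forall s y, s \in S -> y \in nbrs X s -> y.1 \in [seq z.1 | z <- p]) ->
    (forall s, s \in S -> count (bond s) p <= M) ->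
  2 * delta + #|S| <= 2 * M + 2 * count (fun y => y.2 == b) p.
Proof.
move=> good_p S0 Sp S_side S_closed S_max; have p_uniq := lifted_path_uniq good_p.
pose A := [set y in p | y.2 == b]; rewrite (count_card _ p_uniq) -/A.
have SA : S \subset A by apply/subsetP=> s Ss; rewrite inE Sp //= S_side.
pose flips s (T : {set cover}) := #|[set a in T | bond s (flip a)]|.
have deg s : s \in S -> delta <= M + (#|A :\: S| + flips s S).
  move=> Ss; apply: leq_trans (min_degree _) _.
    by case/and3P: good_p => /allP pX _ _; exact: pX (Sp s Ss).
  pose Q := [set y in p | bond s y]; pose F := [set a in A | bond s (flip a)].
  have /subset_leq_card nbrs_sub : nbrs X s \subset Q :|: (@flip @: F).
    apply/subsetP=> y ys; have := ys; rewrite inE => /andP[_ sy].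
    have /mapP[z zp yz] := S_closed s y Ss ys; have y_side := bond_side sy.
    have [zy|zy] := eqVneq z.2 y.2.
      have def_y : y = z by rewrite [y]surjective_pairing yz -zy -surjective_pairing.
      by apply/setUP; left; rewrite inE sy def_y zp.
    have def_y : y = flip z.
      by rewrite [y]surjective_pairing /flip yz; congr pair; case: z.2 y.2 zy => [] [].
    apply/setUP; right; apply/imsetP; exists z; rewrite // !inE zp -def_y sy andbT /=.
    by rewrite -(S_side s Ss); move: y_side; rewrite def_y /= => /negb_inj ->.
  apply: leq_trans nbrs_sub _; apply: leq_trans (leq_card_setU _ _) _.
  apply: leq_add; first by rewrite -(count_card _ p_uniq) S_max.
  apply: leq_trans (leq_imset_card _ _) _; apply: leq_trans (leq_card_setU _ _).
  apply/subset_leq_card/subsetP=> a; rewrite !inE => /andP[-> ->]; rewrite !andbT.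
  by case: (a \in S).
have: \sum_(s in S) delta <= \sum_(s in S) (M + (#|A :\: S| + flips s S)) by exact: leq_sum.
rewrite !big_split /= !sum_nat_const => sum_deg; have flips_le := flip_bonds_le S.
have := subset_leq_card SA; rewrite cardsD (setIidPr SA) in sum_deg *.
(* Multiplying the goal by |S| makes all terms linear in the products below. *)
move: S0; rewrite -card_gt0 => S0 SA_le; rewrite -(leq_pmul2l S0).
rewrite /flips in sum_deg; move: flips_le sum_deg; set Sig := \sum_(_ in _) _.
move: #|S| #|A| S0 SA_le Sig => s a s0 sa Sig flips_le sum_deg.
rewrite mulnBr in sum_deg; have := leq_mul (leqnn s) sa; rewrite !mul2n -!addnn !mulnDr.
rewrite mul2n -addnn in flips_le.
move: (s * delta) (s * M) (s * a) (s * s) flips_le sum_deg; lia.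
Qed.

(** The head x is chosen with the most neighbours on p among the set S of all heads
    of lifted paths that rearrange p and keep its last element.  Rotating at x
    shows that S has at least as many elements as x has neighbours on p; together
    with [max_degree_end] this bounds the number of neighbours from below. *)
Lemma long_end p x0 q0 : p = x0 :: q0 -> lifted_path X p -> size p = m ->
  exists x q, [/\ lifted_path X (x :: q), perm_eq (x :: q) p, last x q = last x0 q0
    & 2 * delta <= count (bond x) p + 2 * uphalf m].
Proof.
move=> def_p good_p size_p; set z := last x0 q0.
pose S := [set s | has (fun q => [&& lifted_path X q, head z q == s & last z q == z])
  (permutations p)].
have SP s : s \in S ->
    exists q, [/\ lifted_path X (s :: q), perm_eq (s :: q) p & last s q = z].
  rewrite inE => /hasP[[|s' q]]; rewrite mem_permutations => q_p.
    by have := perm_size q_p; rewrite def_p.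
  by case/and3P=> good_q /eqP /= <- /eqP last_q; exists q.
have SI s q : lifted_path X (s :: q) -> perm_eq (s :: q) p -> last s q = z -> s \in S.
  move=> good_q q_p last_q; rewrite inE; apply/hasP; exists (s :: q).
    by rewrite mem_permutations.
  by rewrite good_q /= last_q !eqxx.
have x0S : x0 \in S by apply: (SI x0 q0); rewrite -?def_p.
case: (arg_maxnP (fun s => count (bond s) p) x0S) => x xS x_max.
have [q [good_q q_p last_q]] := SP x xS.
exists x, q; split=> //.
have size_S s q' : perm_eq (s :: q') p -> size q' = m.-1.
  by move/perm_size; rewrite size_p => <-.
have S_side s : s \in S -> s.2 = x.2.
  case/SP=> q' [/and3P[_ _ /path_side]]; rewrite /= => s_side q'_p last_q'.
  case/and3P: good_q => _ _ /path_side; rewrite last_q -last_q' s_side.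
  by rewrite (size_S _ _ q_p) (size_S _ _ q'_p) => /addIb.
have S_closed s y : s \in S -> y \in nbrs X s -> y.1 \in [seq v.1 | v <- p].
  case/SP=> q' [good_q' q'_p _] /(nbrs_head good_q').
  by rewrite (perm_mem (perm_map _ q'_p)); apply; rewrite -size_p -(perm_size q'_p).
have Sp : {subset S <= p}.
  by move=> s /SP[q' [_ q'_p _]]; rewrite -(perm_mem q'_p) mem_head.
have S0 : S != set0 by apply/set0Pn; exists x.
have := max_degree_end good_p S0 Sp S_side S_closed x_max.
rewrite -[count (fun _ => _ == _) _](permP q_p) (count_side x.2); last first.
  by case/and3P: good_q.
rewrite eqxx (size_S _ _ q_p) (_ : m.-1.+1 = m); last first.
  by rewrite prednK // -size_p def_p.
suff: count (bond x) p <= #|S| by move=> le_S; move: (count _ _) #|S| le_S => ? ?; lia.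
have q_uniq := lifted_path_uniq good_q.
rewrite (count_card _ (lifted_path_uniq good_p)) -(card_imset _ (can_inj (next_prev q_uniq))).
apply/subset_leq_card/subsetP=> _ /imsetP[y /[!inE] /andP[yp xy] ->].
(* The neighbour y of x is sent to its predecessor, the head of the rotated path. *)
move: yp; rewrite -(perm_mem q_p) inE => /orP[/eqP yx|]; first by rewrite yx bond_irr in xy.
move=> yq; case/splitPr: yq good_q q_p last_q q_uniq => q1 q2 good_q q_p last_q q_uniq.
rewrite prev_splitr //; suff: last x q1 \in S by rewrite inE.
apply: (SI _ (rev (belast x q1) ++ y :: q2)).
- by have := rotation good_q xy; rewrite lastI rev_rcons.
- rewrite -cat_cons -rev_rcons -lastI -(permPr q_p) -[X in perm_eq _ X]cat_cons.
  by rewrite perm_cat2r perm_rev.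
by rewrite -last_q !last_cat.
Qed.

(** * Spanning and near-spanning cycles *)

(** A cycle can be cut open at each of its vertices, so [nbrs_head] confines the
    neighbours of all of them to the m vertices below the cycle. *)
Lemma spanning_cycle_touching c : all (mem X) c -> uniq [seq x.1 | x <- c] ->
    cycle bond c -> size c = m ->
  2 * #|touching X [set y in c]| <= m * m.
Proof.
move=> cX c_uniq c_cyc size_c.
have nbrs_c x y : x \in c -> y \in nbrs X x -> y.1 \in [seq v.1 | v <- c].
  case/(cycle_start c_cyc)=> q q_c xq xy; rewrite -(perm_mem (perm_map _ q_c)).
  apply: nbrs_head xy; last by rewrite -size_c -(perm_size q_c).
  have q_c1 := perm_map fst q_c.
  rewrite /lifted_path -(perm_all (mem X) q_c) in cX *.
  by rewrite cX (perm_uniq q_c1) c_uniq.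
have <- : #|[set u in [seq v.1 | v <- c]]| = m.
  by rewrite cardsE -size_c -(size_map fst); apply/card_uniqP.
apply: card_oriented; apply/subsetP=> -[u v] /mem_touching[uv [uX vX]]; first by [].
rewrite !inE /= => /orP[] ec; have /= mem_c := map_f fst ec; rewrite mem_c ?andbT /=.
  by apply: (nbrs_c _ (v, false) ec); rewrite inE vX.
by apply: (nbrs_c _ (u, true) ec); rewrite inE uX.
Qed.

(** Both copies of some vertex a turn out to be ends of longest paths over the same
    m vertices.  As G is oriented, a vertex of G lies below a neighbour of at most
    one of the two copies, so their degrees add up to at most m. *)
Lemma near_spanning_cycle w c b : all (mem X) (w :: c) -> uniq [seq x.1 | x <- w :: c] ->
    cycle bond c -> b \in c -> bond w b -> (size c).+1 = m -> ~~ odd (size c) ->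
    (size c)./2 < delta ->
  2 * delta <= m.
Proof.
move=> wcX wc_uniq c_cyc bc wb size_c even_c delta_gt.
have good_perm_cycle p : perm_eq p (w :: c) -> sorted bond p -> lifted_path X p.
  move=> p_wc p_path; rewrite /lifted_path p_path (perm_all _ p_wc) wcX.
  by rewrite (perm_uniq (perm_map _ p_wc)) wc_uniq.
have c_uniq : uniq c by move: wc_uniq => /map_uniq /andP[].
have nbrs_w y : y \in nbrs X w -> y.1 \in [seq v.1 | v <- c].
  have [q q_c bq] := cycle_start c_cyc bc.
  have wq_wc : perm_eq [:: w, b & q] (w :: c) by rewrite perm_cons.
  move=> wy; have := nbrs_head (good_perm_cycle _ wq_wc _) _ wy.
  rewrite /= wb bq -size_c -(perm_size q_c) -/(map _ (b :: q)) => /(_ isT erefl).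
  rewrite inE -(perm_mem (perm_map _ q_c)) => /orP[/eqP yw|//].
  by move: wy; rewrite inE => /andP[_ /bond_base]; rewrite yw eqxx.
(* Each neighbour of w is either the opposite copy of some a in A or the successor
   on c of some a in A.  As A has fewer than delta elements, some a serves twice. *)
pose A := [set a in c | a.2 == w.2].
have card_A : #|A| = (size c)./2.
  have [q q_c bq] := cycle_start c_cyc bc.
  rewrite -(count_card _ c_uniq) -(permP q_c) (count_side _ bq).
  rewrite (bond_side wb) -(perm_size q_c) /= in even_c *.
  by case: w.2 => //=.
pose A1 := [set a in A | flip a \in nbrs X w].
pose A2 := [set a in A | next c a \in nbrs X w].
have [a]: exists a, a \in A1 :&: A2.
  apply/set0Pn; rewrite -card_gt0 cardsI.
  suff: delta <= #|A1| + #|A2|.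
    have: #|A1 :|: A2| <= #|A|.
      by apply/subset_leq_card/subsetP=> a; rewrite !inE => /orP[] /andP[].
    by rewrite card_A => le_A lt_delta; rewrite subn_gt0;
      apply: leq_ltn_trans le_A _; apply: leq_trans delta_gt _.
  have wX : w \in X by case/andP: wcX.
  apply: leq_trans (min_degree wX) _.
  apply: leq_trans (leq_add (leq_imset_card flip A1) (leq_imset_card (next c) A2)).
  apply: leq_trans (leq_card_setU _ _); apply/subset_leq_card/subsetP=> y wy.
  have := wy; rewrite inE => /andP[_ /bond_side y_side].
  have /mapP[v vc yv] := nbrs_w y wy; apply/setUP.
  have [vw|vw] := eqVneq v.2 w.2.
    left; apply/imsetP; exists v; rewrite ?inE ?vc ?vw ?eqxx.
      suff -> : flip v = y by rewrite inE in wy.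
      by rewrite [y]surjective_pairing y_side yv -vw.
    by rewrite [LHS]surjective_pairing y_side yv -vw.
  have {yv} def_y : y = v.
    rewrite [y]surjective_pairing [v]surjective_pairing yv y_side.
    by congr pair; case: v.2 w.2 vw => [] [].
  rewrite -{}def_y in vc vw.
  right; apply/imsetP; exists (prev c y); last by rewrite next_prev.
  have cy := wy; rewrite !inE mem_prev vc next_prev //= in cy *; rewrite cy andbT.
  have := next_prev c_uniq y; have := prev_cycle c_cyc vc.
  by move/bond_side; rewrite y_side => /negb_inj ->.
case/setIP=> aA1 aA2; have [ac aw w_flip w_next] :
    [/\ a \in c, a.2 = w.2, flip a \in nbrs X w & next c a \in nbrs X w].
  by move: aA1 aA2; rewrite 4!inE => /andP[/andP[-> /eqP ->] ->]; rewrite inE => /andP[_ ->].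
have [i q def_q] := rot_to ac; case: q def_q => [|b' q] def_q.
  have := next_rot i c_uniq a; rewrite def_q /= eqxx => next_a.
  by move: w_next; rewrite -next_a inE => /andP[_ /bond_side]; rewrite aw; case: w.2.
have next_a : next c a = b' by rewrite -(next_rot i c_uniq) def_q /= eqxx.
rewrite {}next_a !inE in w_next w_flip.
have {w_next} wb' : bond w b' by case/andP: w_next.
have {w_flip} [flip_X w_flip] : flip a \in X /\ bond w (flip a) by case/andP: w_flip.
have q_c : perm_eq [:: a, b' & q] c by rewrite -def_q perm_rot.
have: cycle bond [:: a, b' & q] by rewrite -def_q rot_cycle.
rewrite /= rcons_path => /and3P[ab' b'q qa].
have size_q : (size q).+3 = m by rewrite -size_c -(perm_size q_c).
(* Starting with w, the cycle is followed up to a; reversed, the path has head a. *)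
have good1 : lifted_path X (a :: rev [:: w, b' & q]).
  rewrite -rev_rcons; apply: lifted_path_rev; apply: good_perm_cycle.
    by rewrite /= -cats1 perm_cons -[_ :: q ++ _]/((b' :: q) ++ [:: a]) perm_catC.
  by rewrite /= wb' rcons_path b'q.
(* Here the opposite copy of a takes the place of a. *)
have good2 : lifted_path X [:: flip a, w, b' & q].
  have all_waq : all (mem X) [:: w, a, b' & q].
    by rewrite (perm_all _ (_ : perm_eq _ (w :: c))) // perm_cons.
  have uniq_waq : uniq [seq x.1 | x <- [:: w, a, b' & q]].
    by rewrite (perm_uniq (perm_map _ (_ : perm_eq _ (w :: c)))) // perm_cons.
  apply/and3P; split; first by move: all_waq; rewrite /= flip_X => /and4P[-> _ -> ->].
    by move: uniq_waq; rewrite /= !inE !negb_or [w.1 == a.1]eq_sym;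
      case/and3P => /and3P[-> -> ->] /andP[-> ->] /andP[-> ->].
  by rewrite /= b'q wb' bond_sym w_flip.
pose V := [set u in [seq x.1 | x <- [:: w, a, b' & q]]].
have sub1 y : y \in nbrs X a -> y.1 \in V.
  move=> ay; have := nbrs_head good1 _ ay; rewrite /= size_rev => /(_ size_q).
  by rewrite !inE map_rev mem_rev /= !inE orbCA.
have sub2 y : y \in nbrs X (flip a) -> y.1 \in V.
  move=> ay; have := nbrs_head good2 _ ay; rewrite /= => /(_ size_q).
  by rewrite !inE orbCA.
have fst_inj x : {in nbrs X x &, injective (@fst G bool)}.
  move=> u v; rewrite !inE => /andP[_ /bond_side xu] /andP[_ /bond_side xv] uv.
  by rewrite [u]surjective_pairing [v]surjective_pairing uv xu xv.
have aX : a \in X by move/allP: wcX; apply; rewrite inE ac orbT.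
rewrite mul2n -addnn; apply: leq_trans (leq_add (min_degree aX) (min_degree flip_X)) _.
rewrite -(card_in_imset (@fst_inj a)) -(card_in_imset (@fst_inj (flip a))).
have card_V : #|V| <= m by rewrite cardsE (leq_trans (card_size _)) // size_map /= size_q.
apply: leq_trans card_V.
rewrite -cardsUI (_ : _ :&: _ = set0) ?cards0 ?addn0.
  apply/subset_leq_card/subsetP=> u /setUP[] /imsetP[y ys ->]; [exact: sub1|exact: sub2].
apply/setP=> u; rewrite !inE; apply/negP=> /andP[/imsetP[y ay ->] /imsetP[y' ay' yy']].
have def_y : y' = flip y.
  move: ay ay'; rewrite !inE => /andP[_ /bond_side ay] /andP[_ /bond_side ay'].
  by rewrite [LHS]surjective_pairing -yy' ay' /flip ay.
move: ay ay'; rewrite def_y !inE => /andP[_ /bond_flip/negP ay] /andP[_]; exact: ay.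
Qed.

End LongestPath.

(** * Closing a path into a cycle *)

(** The ends x and z lie on opposite sides.  If x is joined to the vertex after
    position i and z to the vertex at position i, then [splice_cycle] applies to the
    pieces on either side.  Both conditions force position i onto the side of x,
    which occurs uphalf (size q) times. *)
Lemma even_crossing x q (z := last x q) : path bond x q -> odd (size q) ->
    uphalf (size q) < count (bond x) (x :: q) + count (bond z) (x :: q) ->
  exists c, perm_eq c (x :: q) /\ cycle bond c.
Proof.
move=> xq odd_q; have z_side : z.2 = ~~ x.2 by rewrite (path_side xq) odd_q addbT.
have -> : count (bond x) (x :: q) = count (bond x) q by rewrite /= bond_irr.
have -> : count (bond z) (x :: q) = count (bond z) (belast x q).
  by rewrite lastI -cats1 count_cat /= bond_irr !addn0.
rewrite (count_sum_nth x) [count (bond z) _](count_sum_nth x) size_belast.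
have belast_nth i : i < size q -> nth x (belast x q) i = nth x (x :: q) i.
  by move=> lt_i; rewrite [in RHS]lastI nth_rcons size_belast lt_i.
have step i : i < size q -> bond (nth x (x :: q) i) (nth x q i).
  by move=> lt_i; apply/(pathP x).
set n := uphalf _ => lt_n.
have [|||i [lt_i xi zi]] := @crossing_index (size q) (fun i => bond x (nth x q i))
  (fun i => bond z (nth x (belast x q) i)) (fun i => (nth x (x :: q) i).2 == x.2).
- by move=> i /step /bond_side + /bond_side => ->; case: x.2 (_.2) => [] [].
- move=> i /belast_nth -> /bond_side ->; rewrite z_side.
  by case: x.2.
- apply: leq_ltn_trans lt_n.
  have := count_side x.2 xq; rewrite eqxx (count_sum_nth x) big_ord_recr /= => sum_side.
  have: (last x q).2 != x.2 by rewrite -/z z_side; case: x.2.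
  rewrite /n (last_nth x) => /negbTE last_side; rewrite last_side addn0 in sum_side.
  by rewrite sum_side /=; lia.
exists ((x :: take i q) ++ rev (nth x q i :: drop i.+1 q)); split.
  rewrite -drop_nth // -[in X in perm_eq _ X](cat_take_drop i q) -cat_cons perm_cat2l.
  by rewrite perm_rev.
have := xq; rewrite -[in X in X -> _](cat_take_drop i q) (drop_nth x lt_i) cat_path /=.
case/and3P=> xq1 _ q2_path; apply: splice_cycle => //; first exact: bond_sym.
rewrite take_last; last exact: ltnW.
have -> : last (nth x q i) (drop i.+1 q) = z.
  by rewrite /z -[in RHS](cat_take_drop i q) (drop_nth x lt_i) last_cat.
by rewrite bond_sym -belast_nth.
Qed.

(** Now x and z lie on the same side.  If x is joined to the vertex after w and z to
    the vertex before w, the two pieces left by deleting w form a cycle, and w is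
    on the side of x.  Only an interior w is sought, so at most one neighbour of
    each end is ignored: the vertex next to x, and the vertex next to z. *)
Lemma odd_crossing x y q (z := last y q) : path bond x (y :: q) -> odd (size q) ->
    uphalf (size q) + 3 < count (bond x) (x :: y :: q) + count (bond z) (x :: y :: q) ->
  exists w c b, [/\ perm_eq (w :: c) (x :: y :: q), cycle bond c, b \in c & bond w b].
Proof.
move=> xq odd_q; have := path_side xq; rewrite [last _ _]/= -/z /= odd_q addbF => z_side.
have step i : i <= size q -> bond (nth x (x :: y :: q) i) (nth x (y :: q) i).
  by move=> le_i; apply: (pathP x xq).
have count_x : count (bond x) (x :: y :: q) <= (count (bond x) q).+1.
  by rewrite /= bond_irr; case: (bond x y).
have count_z : count (bond z) (x :: y :: q) <= (count (bond z) (take (size q) (x :: y :: q))).+1.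
  rewrite -[X in count _ X <= _](cat_take_drop (size q)) count_cat -addn1 leq_add2l.
  have size_drop : size (drop (size q) (x :: y :: q)) = 2 by rewrite size_drop /=; lia.
  have := congr1 (last z) (cat_take_drop (size q) (x :: y :: q)); rewrite last_cat /=.
  case: drop size_drop => [|u [|v []]] //= _; rewrite -/z => ->.
  by rewrite bond_irr addn0; case: (bond z u).
move=> lt_n; have {count_x count_z} lt_n : uphalf (size q) + 1 <
    count (bond x) q + count (bond z) (take (size q) (x :: y :: q)).
  by have := leq_trans lt_n (leq_add count_x count_z); rewrite addSn !addnS !addn0 !ltnS.
have size_t : size (take (size q) (x :: y :: q)) = size q by rewrite size_takel //=; lia.
rewrite (count_sum_nth x) [count (bond z) _](count_sum_nth x) size_t in lt_n.
have take_nth i : i < size q -> nth x (take (size q) (x :: y :: q)) i = nth x (x :: y :: q) i.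
  by move=> lt_i; rewrite nth_take.
have [|||i [lt_i xi zi]] := @crossing_index (size q) (fun i => bond x (nth x q i))
  (fun i => bond z (nth x (take (size q) (x :: y :: q)) i)) (fun i => (nth x (y :: q) i).2 == x.2).
- by move=> i /step /bond_side /= + /bond_side => ->; case: x.2 (_.2) => [] [].
- move=> i lt_i; rewrite take_nth // => /bond_side; have /bond_side -> := step i (ltnW lt_i).
  by rewrite z_side => ->; rewrite negbK.
- apply: leq_ltn_trans lt_n.
  have /andP[/bond_side y_side yq] : bond x y && path bond y q by [].
  apply: (@leq_trans (count (fun v => v.2 == x.2) (y :: q))).
    by rewrite (count_sum_nth x) big_ord_recr leq_addr.
  rewrite (count_side x.2 yq) y_side uphalfE.
  by case: x.2; rewrite leq_addr.
exists (nth x (y :: q) i), ((x :: take i (y :: q)) ++ rev (nth x q i :: drop i.+1 q)), (nth x q i).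
have lt_i1 : i < size (y :: q) by rewrite /= ltnS ltnW.
have def_q : y :: q = take i (y :: q) ++ nth x (y :: q) i :: nth x q i :: drop i.+1 q.
  by rewrite -[LHS](cat_take_drop i) (drop_nth x lt_i1) /= (drop_nth x lt_i).
split.
- have def_p : x :: y :: q = (x :: take i (y :: q)) ++ [:: nth x (y :: q) i] ++
      nth x q i :: drop i.+1 q by rewrite {1}def_q.
  by rewrite [X in perm_eq _ X]def_p perm_sym perm_catCA perm_cons perm_cat2l perm_sym perm_rev.
- have := xq; rewrite [in X in X -> _]def_q cat_path /=.
  case/and4P=> xq1 _ _ q2_path; apply: splice_cycle => //; first exact: bond_sym.
  rewrite take_last; last exact: ltnW.
  have -> : last (nth x q i) (drop i.+1 q) = z.
    by have := congr1 (last x) def_q; rewrite last_cat /= -/z => ->.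
  by rewrite bond_sym -take_nth.
- by rewrite mem_cat mem_rev mem_head orbT.
exact: step lt_i.
Qed.

(** * Alternating paths from density *)

(** If no lifted path has exactly k vertices then none is longer, as a longer one
    could be truncated.  Both ends of a longest path are given many neighbours by
    applying [long_end], reversing, and applying it again: the second application
    keeps the end obtained first. *)
Lemma dense_long_path k X : 0 < k -> X != set0 ->
    (forall S, S \subset X -> S != set0 -> (5 * k + 4) * #|S| < 8 * #|touching X S|) ->
  exists2 p, lifted_path X p & size p = k.
Proof.
move=> k_gt0 /set0Pn[x1 x1X] dense.
pose P n := [exists t : n.-tuple cover, lifted_path X t].
have PE p : lifted_path X p -> P (size p).
  by move=> good_p; apply/existsP; exists (in_tuple p).
have [/existsP[t good_t]|no_k] := boolP (P k); first by exists t; rewrite ?size_tuple.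
exfalso.
have short p : lifted_path X p -> size p < k.
  move=> good_p; rewrite ltnNge; apply: contra no_k => le_k.
  rewrite -(size_takel le_k); apply: PE; case/and3P: good_p => pX p_uniq p_path.
  rewrite /lifted_path map_take take_uniq // take_sorted // andbT andbT.
  by apply/allP=> y /mem_take /(allP pX).
have [||m /existsP[p0 good_p0] m_max] := @ex_maxnP P k.
- by exists 0; apply: (PE [::]).
- by move=> n /existsP[t /short]; rewrite size_tuple => /ltnW.
have longest p : lifted_path X p -> size p <= m by move/PE/m_max.
have m_lt : m < k by rewrite -(size_tuple p0) short.
have m_gt0 : 0 < m by apply: (longest [:: x1]); rewrite /lifted_path /= x1X.
have [delta delta_ge min_degree] : exists2 delta, 5 * k + 5 <= 8 * delta
    & forall x, x \in X -> delta <= #|nbrs X x|.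
  exists ((5 * k + 4) %/ 8).+1; first by lia.
  move=> x xX; apply: leq_trans (card_touching1 X x); rewrite ltn_divLR // [_ * 8]mulnC.
  have := dense [set x]; rewrite cards1 muln1; apply; first by rewrite sub1set.
  by apply/set0Pn; exists x; rewrite inE.
have size_p0 := size_tuple p0; move: (tval p0) size_p0 good_p0 => {}p0 size_p0 good_p0.
case def_p0: p0 size_p0 => [|x0 q0] size_p0; first by rewrite -size_p0 in m_gt0.
rewrite -def_p0 in size_p0.
have [z [q1 [good_q1 q1_p0 _ z_deg]]] := long_end longest min_degree def_p0 good_p0 size_p0.
have def_rev : rev (z :: q1) = last z q1 :: rev (belast z q1) by rewrite lastI rev_rcons.
have size_q1 : size (rev (z :: q1)) = m by rewrite size_rev (perm_size q1_p0).
have [x [q [good_q q_q1 last_q x_deg]]] :=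
  long_end longest min_degree def_rev (lifted_path_rev good_q1) size_q1.
have {}last_q : last x q = z.
  rewrite last_q -[LHS]/(last x (last z q1 :: rev (belast z q1))) -def_rev.
  by rewrite rev_cons last_rcons.
have q_p0 : perm_eq (x :: q) p0.
  by apply: perm_trans q1_p0; apply: perm_trans q_q1 _; rewrite perm_rev.
rewrite -(permP q_p0) in z_deg; rewrite -(permP q_q1) in x_deg.
have size_q : (size q).+1 = m by rewrite -size_p0 -(perm_size q_p0).
have /and3P[qX q_uniq q_path] := good_q.
have [odd_q|even_q] := boolP (odd (size q)).
  have [|c [c_q c_cyc]] := even_crossing q_path odd_q.
    rewrite -size_q in m_lt z_deg x_deg; rewrite last_q.
    exact: even_crossing_bound odd_q m_lt delta_ge x_deg z_deg.
  have cX : all (mem X) c by rewrite (perm_all _ c_q).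
  have c_uniq : uniq [seq v.1 | v <- c] by rewrite (perm_uniq (perm_map _ c_q)).
  have size_c : size c = m by rewrite (perm_size c_q).
  have card_c : #|[set v in c]| = m.
    by rewrite cardsE -size_c; apply/card_uniqP; apply: map_uniq c_uniq.
  have := spanning_cycle_touching longest cX c_uniq c_cyc size_c.
  have: (5 * k + 4) * #|[set v in c]| < 8 * #|touching X [set v in c]|.
    apply: dense; first by apply/subsetP=> v; rewrite inE => /(allP cX).
    by rewrite -card_gt0 card_c.
  by rewrite card_c ltnNge => /negP dense_c /(spanning_cycle_bound m_lt).
case: q => [|y q] in size_q q_path even_q last_q z_deg x_deg q_p0 qX q_uniq good_q q_q1.
  move: x_deg m_lt delta_ge; rewrite -size_q /= bond_irr muln1 => x_deg m_lt delta_ge.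
  by clear -x_deg m_lt delta_ge; lia.
have [||w [c [b [wc_q c_cyc bc wb]]]] := odd_crossing q_path.
- by rewrite /= negbK in even_q.
- rewrite [last y q]last_q; rewrite -size_q in m_lt z_deg x_deg.
  rewrite /= negbK in even_q.
  exact: odd_crossing_bound even_q m_lt delta_ge x_deg z_deg.
have wcX : all (mem X) (w :: c) by rewrite (perm_all _ wc_q).
have wc_uniq : uniq [seq v.1 | v <- w :: c] by rewrite (perm_uniq (perm_map _ wc_q)).
have size_c : (size c).+1 = m by rewrite -size_q; exact: perm_size wc_q.
have even_c : ~~ odd (size c) by move: (perm_size wc_q) => [->].
have half_c : (size c)./2 < delta.
  by move: size_c m_lt delta_ge => <-; rewrite -divn2; move: (size c) => n; clear; lia.
have := near_spanning_cycle longest min_degree wcX wc_uniq c_cyc bc wb size_c even_c half_c.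
by clear -m_lt delta_ge; lia.
Qed.

(** A vertex is used through one copy only; through its out-copy it has only outgoing
    edges on the path, through its in-copy only incoming ones. *)
Lemma lifted_path_alternating X p : lifted_path X p ->
  is_path [seq x.1 | x <- p] /\ is_alternating [seq x.1 | x <- p].
Proof.
case/and3P=> _ p_uniq p_path; split.
  rewrite /is_path p_uniq /=; case: p p_path {p_uniq} => //= x p.
  rewrite path_map; apply: sub_path => u v /andP[_]; rewrite /adjacent /=.
  by case: ifP => _ ->; rewrite ?orbT.
(* Consecutive vertices of the projected path come from bonded elements of p. *)
have cons_bond u v : consecutive [seq x.1 | x <- p] u v ->
    exists x y, [/\ x \in p, y \in p, x.1 = u, y.1 = v & bond x y].
  have infix_bond a b : infix [:: a; b] [seq x.1 | x <- p] ->
      exists x y, [/\ x \in p, y \in p, x.1 = a, y.1 = b & bond x y].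
    case/infixP=> s1 [s2 def_p]; have def_p' := cat_take_drop (size s1) p.
    have size_s1 : size s1 <= size p.
      by rewrite -(size_map fst p) def_p size_cat leq_addr.
    move: def_p; rewrite -{1}def_p' map_cat => /eqP.
    rewrite eqseq_cat ?size_map ?size_takel // => /andP[_ /eqP].
    case def_d: (drop _ _) => [|x [|y d]] //= [xa yb _].
    exists x, y; rewrite xa yb -def_p' def_d !mem_cat !inE !eqxx !orbT; split=> //.
    move: p_path; rewrite -def_p' def_d; case: (take _ _) => [/andP[]//|v' t] /=.
    by rewrite cat_path /= => /and4P[].
  case/orP=> /infix_bond[x [y [xp yp xu yv xy]]]; first by exists x, y.
  by exists y, x; rewrite bond_sym.
have side_inj x y : x \in p -> y \in p -> x.1 = y.1 -> x = y.
  exact: uniq_map_inj_in p_uniq x y.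
move=> _ /mapP[x xp ->]; case x_side: x.2; [right|left] => u; apply/negP;
  rewrite inE => /andP[/= ux /cons_bond[a [b [ap bp]]]].
- move=> au bx; rewrite (side_inj _ _ bp xp bx) /bond x_side => /andP[a_side].
  by case: ifP a_side => // _ _; rewrite au => /edges_oriented; rewrite ux.
- move=> ax bu; rewrite (side_inj _ _ ap xp ax) /bond x_side bu => /andP[_].
  by move/edges_oriented; rewrite ux.
Qed.

End DoubleCover.

Local Open Scope ring_scope.

Theorem corollary1p3 (k : nat) (G : oriented_graph) (k_gt0 : (0 < k)%N)
    (many_edges :
      (5 * k%:R + 4) * #|G|%:R / 4 < #|edges G|%:R :> rat) :
  exists p : seq G, [/\ is_path p, is_alternating p & size p = k].
Proof.
have dense_G : ((5 * k + 4) * (#|G| * 2) < 8 * #|edges G|)%N.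
  move: many_edges; rewrite ltr_pdivrMr // -!(natrM, natrD) ltr_nat.
  by move: #|G| #|edges G| => n e; lia.
have [X [X0 dense]] := minimal_dense dense_G.
have [p good_p size_p] := dense_long_path k_gt0 X0 dense.
have [p_path p_alt] := lifted_path_alternating good_p.
by exists [seq x.1 | x <- p]; rewrite size_map.
Qed.
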